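(* Let $\phi:[0,\infty)\to[0,\infty)$ be convex and increasing with $\phi(0)=0$, let $\psi(t)=e^{\phi(t)}-1$, and let $\|\cdot\|_\psi$ be the corresponding Orlicz norm (an Orlicz norm of exponential type). Let $$\phi^*(\lambda)=\sup_{t\ge0}\,(\lambda t-\phi(t))$$ be the convex conjugate of $\phi$. If for some $M>0$ we have $$\inf_{\lambda\ge0}\ \frac{e^{\phi^*(\lambda)}-1}{\lambda^2}\ \ge\ M\int_0^\infty t\,e^{-\phi(t)/2}\,dt,$$ then for every $f\in\mathbb V$ (and every $r\ge0$), $$T_r(f)\le\max\left\{3,\frac{3}{\sqrt{2M}}\right\}\phi^{-1}(2r/3)\,\|f\|_\psi .$$
   Context: $X$ is a random variable with values in a space $\mathcal X$. $\mathbb V$ is a vector space of (measurable) functions $g:\mathcal X\to\mathbb R$ such that $\mathbb E g(X)=0$ and $\{\lambda\in\mathbb R:\log\mathbb E e^{\lambda g(X)}<\infty\}$ contains $0$ in its interior; here it is assumed that $\|g\|_\psi<\infty$ for all $g\in\mathbb V$. For a convex increasing $\psi:[0,\infty)\to[0,\infty)$ with $\psi(0)=0$, $$\|g\|_\psi=\|g(X)\|_\psi=\inf\{u>0:\mathbb E\,\psi(|g(X)|/u)\le1\}.$$ For $r\ge0$ and $g\in\mathbb V$, $$T_r(g)=\inf_{\lambda\ge0}\frac{r+\log\mathbb E e^{\lambda g(X)}}{\lambda}.$$ (In infima of quotients over $\lambda\ge0$, the value $\lambda=0$ is excluded, and values of $\lambda$ for which the numerator is $+\infty$ contribute $+\infty$.)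 ''Increasing'' means strictly increasing, and $\phi^{-1}:[0,\infty)\to[0,\infty)$ is the inverse function of $\phi$. *)

(* Defs.v *)
From HB Require Import structures.
From mathcomp Require Export all_boot all_order all_algebra.
From mathcomp Require Export all_classical all_reals all_analysis.

Set Implicit Arguments.
Unset Strict Implicit.
Unset Printing Implicit Defensive.

Import Order.TTheory GRing.Theory Num.Theory.
Import numFieldNormedType.Exports.

Local Open Scope classical_set_scope.
Local Open Scope ring_scope.

(* Functions [0, +oo[ -> [0, +oo[ are encoded as total functions R -> R of
   which only the values on [0, +oo[ are ever used. *)
Record is_young (R : realType) (phi : R -> R) : Prop := IsYoung {
  young_ge0 : forall t : R, 0 <= t -> 0 <= phi t ;
  young_convex : convex_function (`[0, +oo[%classic : set R) phi ;
  young_increasing : {in `[0, +oo[ &, {homo phi : s t / s < t}} ;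
  young0 : phi 0 = 0 }.

(* The inverse [0, +oo[ -> [0, +oo[ of an increasing phi; the default value 0
   outside of the range of phi on [0, +oo[ is never used. *)
Definition young_inv (R : realType) (phi : R -> R) : R -> R :=
  'pinv_(fun=> 0) `[0, +oo[ phi.

Definition convex_conjugate (R : realType) (phi : R -> R) (l : R) : \bar R :=
  ereal_sup [set (l * t - phi t)%:E | t in [set t | 0 <= t]].

Definition orlicz_norm d (T : measurableType d) (R : realType)
    (P : probability T R) (psi : R -> R) (Y : T -> R) : \bar R :=
  ereal_inf [set u%:E | u in
    [set u | 0 < u /\ ('E_P[(fun w => psi (`|Y w| / u))%R] <= 1)%E]].

Definition log_mgf d (T : measurableType d) (R : realType)
    (P : probability T R) (Y : T -> R) (l : R) : \bar R :=
  lne ('M_P Y l)%E.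

(* Infimum over l > 0 of (r + log_mgf P Y l) / l: as l > 0, a term with log_mgf P Y l = +oo equals +oo. *)
Definition transport_bound d (T : measurableType d) (R : realType)
    (P : probability T R) (Y : T -> R) (r : R) : \bar R :=
  ereal_inf [set ((r%:E + log_mgf P Y l) * (l^-1)%:E)%E | l in
    [set l | 0 < l]].

Record centered_exp_space d d' (Omega : measurableType d)
    (S : measurableType d') (R : realType) (P : probability Omega R)
    (X : {RV P >-> S}) (V : set (S -> R)) : Prop := CenteredExpSpace {
  ces_submod : submod_closed [in V] ;
  ces_measurable : forall g, V g -> measurable_fun [set: S] g ;
  ces_centered : forall g, V g -> ('E_P[g \o X] = 0)%E ;
  ces_mgf : forall g, V g ->
    [set l : R | (log_mgf P (g \o X) l < +oo)%E]° 0 }.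
Arguments centered_exp_space {d d' Omega S R} P X V.

(* Main.v *)
Require Import Defs.
From mathcomp Require Import measurable_realfun ring lra.
Import Order.TTheory GRing.Theory Num.Theory.
Import numFieldNormedType.Exports.

Local Open Scope classical_set_scope.
Local Open Scope ring_scope.

(* Fix u > 0 with E psi(|Y|/u) <= 1 and t > 0 with phi(t) >= 2r/3. Let m be a
   subgradient of phi at t and a = m t - phi(t) = phi^*(m). As exp(-phi/2)
   decreases, s^2/2 exp(-phi(s)/2) is at most the integral of the hypothesis,
   hence at most (e^a - 1)/(M m^2); no tail estimate is needed. With C the
   constant of the theorem and l = 3m/(2C) <= m/2, the bounds
   e^x <= 1 + x + x^2/2 e^|x| and l s <= (phi(s) + a)/2 then give
     e^(lx) <= 1 + lx + (e^a - 1) e^(a/2)/2 * e^phi(|x|)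
   for x = Y/u, and therefore
     E e^(lY/u) <= 1 + (e^a - 1) e^(a/2) <= e^(3a/2).
   The value l/u of the parameter yields T_r(Y) <= C t u; let t decrease to
   phi^-1(2r/3) and u to the norm of Y. *)

(** * Convex increasing functions: chords, subgradients, continuity, inverse *)

Section young_function.
Set Implicit Arguments.
Unset Strict Implicit.
Context {R : realType} (phi : R -> R).
Hypothesis phiY : is_young phi.

(** Convexity with denominators cleared: the degenerate case [x = z] is included, and later uses
    become plain arithmetic. *)
Lemma young_chord (x y z : R) : 0 <= x -> x <= y -> y <= z ->
  (z - x) * phi y <= (z - y) * phi x + (y - x) * phi z.
Proof.
move=> x0 xy yz; have [xz|xz] := eqVneq x z.
  have -> : y = z by apply/eqP; rewrite eq_le yz -xz xy.
  by rewrite xz subrr !mul0r addr0.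
have zx0 : 0 < z - x by rewrite subr_gt0 lt_neqAle xz (le_trans xy).
have t01 : 0 <= (z - y) / (z - x) <= 1.
  by rewrite divr_ge0 ?(ltW zx0) ?subr_ge0//= ler_pdivrMr// mul1r lerD2l lerN2.
have /andP[t0 t1] := t01.
pose t : {i01 R} := Itv01 t0 t1.
have xD : x \in (`[0, +oo[%classic : set R) by rewrite inE/= in_itv/= x0.
have zD : z \in (`[0, +oo[%classic : set R).
  by rewrite inE/= in_itv/= andbT (le_trans x0)// (le_trans xy).
have := young_convex phiY t xD zD.
rewrite [X in phi X](_ : _ = y); last first.
  rewrite [LHS](_ : _ = (z - y) / (z - x) * x + (1 - (z - y) / (z - x)) * z)//.
  by field; rewrite gt_eqF.
rewrite convRE/= /unstable.onem.
rewrite -(ler_pM2l zx0) => /le_trans; apply.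
rewrite le_eqVlt; apply/orP; left; apply/eqP.
by field; rewrite gt_eqF.
Qed.

Lemma young_homo_lt (s t : R) : 0 <= s -> s < t -> phi s < phi t.
Proof.
move=> s0 st; apply: (young_increasing phiY) => //; rewrite in_itv/= andbT//.
by rewrite (le_trans s0)// ltW.
Qed.

Lemma young_homo_le (s t : R) : 0 <= s -> s <= t -> phi s <= phi t.
Proof.
move=> s0; rewrite le_eqVlt => /predU1P[->//|st].
by rewrite ltW// young_homo_lt.
Qed.

(** The slope is the supremum of the chord slopes to the left of [t]. Every chord slope to the right
    bounds them from above, and the chord from 0 makes the supremum positive. *)
Lemma young_subgradient (t : R) : 0 < t ->
  exists2 m, 0 < m & forall s, 0 <= s -> m * s - phi s <= m * t - phi t.
Proof.
move=> t0.
pose A := [set (phi t - phi s) / (t - s) | s in [set s | 0 <= s < t]].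
have A0 : A ((phi t - phi 0) / (t - 0)) by exists 0 => //=; rewrite lexx.
have Aub z : t < z -> ubound A ((phi z - phi t) / (z - t)).
  move=> tz _ [s /= /andP[s0 st] <-].
  rewrite ler_pdivrMr ?subr_gt0// mulrAC ler_pdivlMr ?subr_gt0//.
  by have := young_chord s0 (ltW st) (ltW tz); lra.
have supA : has_sup A.
  by split; [eexists; exact: A0|exists ((phi (t + 1) - phi t) / (t + 1 - t));
    apply: Aub; rewrite ltrDl].
exists (sup A).
  apply: lt_le_trans (ub_le_sup supA.2 A0).
  by rewrite subr0 divr_gt0// subr_gt0 young_homo_lt.
move=> s s0; have [st|ts|->//] := ltgtP s t.
  have As : A ((phi t - phi s) / (t - s)) by exists s => //=; rewrite s0.
  by have := ub_le_sup supA.2 As; rewrite ler_pdivrMr ?subr_gt0//; lra.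
have := ge_sup supA.1 (Aub s ts).
by rewrite ler_pdivlMr ?subr_gt0//; lra.
Qed.

(* The values of phi on negative reals are arbitrary; composing with max 0
   gives a function that is monotone and continuous on the whole line. *)
Lemma young_max_homo : {homo (fun t : R => phi (Num.max 0 t)) : s t / s <= t}.
Proof.
move=> s t st; apply: young_homo_le; first by rewrite le_max lexx.
by rewrite ge_max le_max lexx/= le_max st orbT.
Qed.

Lemma young_max_continuous : continuous (fun t : R => phi (Num.max 0 t)).
Proof.
move=> x; pose B := `|x| + 1.
have B0 : 0 < B by rewrite ltr_wpDl.
(* By convexity a chord slope left of [B] is at most the slope from there to [2 * B]; that last
   chord has length at least [B] and rises by at most [phi (2 * B)]. *)
have lip s t : s <= t -> t <= B ->
    phi (Num.max 0 t) - phi (Num.max 0 s) <= (t - s) * (phi (2 * B) / B).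
  move=> st tB.
  have K0 : 0 <= phi (2 * B) / B.
    by rewrite divr_ge0 ?(ltW B0)// (young_ge0 phiY)// mulr_ge0// ltW.
  set s' := Num.max 0 s; set t' := Num.max 0 t.
  have s'0 : 0 <= s' by rewrite le_max lexx.
  have s't' : s' <= t' by rewrite ge_max /t' !le_max lexx st orbT.
  have t'B : t' <= B by rewrite ge_max (ltW B0).
  have ts' : t' - s' <= t - s.
    by rewrite /t' /s' /Num.max; case: ltP => h1; case: ltP => h2; lra.
  apply: le_trans (ler_wpM2r K0 ts').
  rewrite mulrA ler_pdivlMr//.
  have B2 : B <= 2 * B by lra.
  have := young_chord s'0 s't' (le_trans t'B B2).
  have := young_homo_le s'0 s't'.
  have := young_ge0 phiY (le_trans s'0 s't').
  nra.
have {}lip s t : s <= B -> t <= B ->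
    `|phi (Num.max 0 s) - phi (Num.max 0 t)| <= `|s - t| * (phi (2 * B) / B).
  wlog st : s t / s <= t.
    move=> h sB tB; have [/h|/ltW/h] := leP s t; first exact.
    by rewrite distrC (distrC s); exact.
  move=> sB tB; rewrite distrC (distrC s) ger0_norm ?subr_ge0 ?young_max_homo//.
  by rewrite (@ger0_norm _ (t - s)) ?subr_ge0//; exact: lip.
have xB : x < B by rewrite (le_lt_trans (ler_norm x))// ltrDl.
set K := phi (2 * B) / B in lip.
have K0 : 0 <= K.
  by rewrite divr_ge0 ?(ltW B0)// (young_ge0 phiY)// mulr_ge0// ltW.
apply/cvgrPdist_le => /= e e0.
near=> y.
have yB : y < B by near: y; exact: lt_nbhsl.
apply: le_trans (lip _ _ (ltW xB) (ltW yB)) _.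
have : `|x - y| <= e / (K + 1).
  near: y; apply: cvgr_dist_le; first exact: cvg_id.
  by rewrite divr_gt0// ltr_wpDl.
rewrite ler_pdivlMr ?ltr_wpDl// => h; apply: le_trans h.
by rewrite ler_wpM2l// lerDl.
Unshelve. all: end_near. Qed.

Lemma young_surj (y : R) : 0 <= y -> exists2 t, 0 <= t & phi t = y.
Proof.
move=> y0; have p1 : 0 < phi 1.
  by rewrite -(young0 phiY) young_homo_lt.
(* Convexity and [phi 0 = 0] give [phi B >= B * phi 1 = phi 1 + y], so [y] lies between the values
   at 0 and [B]. *)
pose B := 1 + y / phi 1.
have B1 : 1 <= B by rewrite lerDl divr_ge0// ltW.
have yB : y <= phi B.
  have := young_chord (lexx 0) ler01 B1.
  rewrite (young0 phiY) !subr0 mulr0 add0r mul1r; apply: le_trans.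
  by rewrite mulrDl mul1r divfK ?gt_eqF// lerDr ltW.
have B0 : 0 <= B by rewrite (le_trans ler01).
have := @IVT R (fun t => phi (Num.max 0 t)) 0 B y B0.
case.
- exact/continuous_subspaceT/young_max_continuous.
- by rewrite maxxx (max_idPr B0) (young0 phiY) ge_min y0/= le_max yB orbT.
move=> c; rewrite in_itv/= => /andP[c0 _]; rewrite (max_idPr c0) => <-.
by exists c.
Qed.

Lemma young_invKV (t : R) : 0 <= t -> young_inv phi (phi t) = t.
Proof.
move=> t0; rewrite /young_inv pinvKV//; last by rewrite inE/= in_itv/= t0.
move=> u v; rewrite !inE/= !in_itv/= !andbT => u0 v0 uv.
by have [/(young_homo_lt u0)|/(young_homo_lt v0)|//] := ltgtP u v;
  rewrite uv ltxx.
Qed.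

Lemma young_inv_spec (y : R) : 0 <= y ->
  0 <= young_inv phi y /\ phi (young_inv phi y) = y.
Proof. by move=> /young_surj[t t0 <-]; rewrite young_invKV. Qed.

End young_function.

(** * A quadratic bound on the exponential, and the weight integral *)

Lemma expR_le_quadratic {R : realType} (x : R) :
  expR x <= 1 + x + x ^+ 2 / 2 * expR `|x|.
Proof.
have mono (f : R -> R) (df : R -> R) (y : R) :
    (forall t : R, is_derive t 1 f (df t)) ->
    (forall t, 0 < t -> 0 <= df t) -> 0 <= y -> f 0 <= f y.
  move=> fdf df0 y0; apply: (@ger0_derive1_ndecr _ f 0 y) => //.
  - move=> t; rewrite in_itv/= => /andP[t0 _].
    by rewrite derive1E derive_val df0.
  - apply: continuous_subspaceT => t; apply: differentiable_continuous.
    by apply/derivable1_diffP; case: (fdf t).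
(* For [x >= 0], division by e^x leaves 1 <= (1 + x) e^(-x) + x^2/2, an equality at 0 whose right
   side has derivative x (1 - e^(-x)) >= 0. *)
have [x0|x0] := leP 0 x.
  have df (t : R) : is_derive t 1
      (fun t : R => (1 + t) * expR (- t) + t ^+ 2 / 2) (t * (1 - expR (- t))).
    by apply: is_derive_eq; rewrite /GRing.scale/= mulr0; field.
  have /(_ _ x0) := mono _ _ x df.
  rewrite (ger0_norm x0) oppr0 expR0 addr0 mulr1 expr0n/= mul0r addr0 => h.
  have {}h : 1 <= (1 + x) * expR (- x) + x ^+ 2 / 2.
    apply: h => t t0.
    by rewrite mulr_ge0 ?(ltW t0)// subr_ge0 -expR0 ler_expR oppr_le0 ltW.
  move: h; rewrite -(ler_pM2l (expR_gt0 x)) mulr1 mulrDr mulrCA -expRD subrr.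
  by rewrite expR0 mulr1 (mulrC (expR x)).
(* For [x < 0] the bound holds even without the factor e^|x|. The function below vanishes at 0, has
   derivative >= 0 since e^(-t) >= 1 - t, and is evaluated at [- x]. *)
have df (t : R) : is_derive t 1
    (fun t : R => 1 - t + t ^+ 2 / 2 - expR (- t)) (-1 + t + expR (- t)).
  by apply: is_derive_eq; rewrite /GRing.scale/= mulr0; field.
have x0' : 0 <= - x by rewrite oppr_ge0 ltW.
have /(_ _ x0') := mono _ _ (- x) df.
rewrite oppr0 opprK expR0 addr0 expr0n/= mul0r addr0 subrr sqrrN subr_ge0 => h.
apply: le_trans (h _) _.
  by move=> t _; have := expR_ge1Dx (- t); lra.
by rewrite lerD2l ler_peMr ?divr_ge0 ?sqr_ge0// -expR0 ler_expR.
Qed.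

Lemma young_weight_integral {R : realType} (phi : R -> R) (t : R) :
  is_young phi -> 0 <= t ->
  ((t ^+ 2 / 2 * expR (- phi t / 2))%:E <=
   \int[lebesgue_measure]_(s in `[0%R, +oo[) (s * expR (- phi s / 2))%:E)%E.
Proof.
move=> phiY; rewrite le_eqVlt => /predU1P[<-|t0].
  rewrite expr0n/= !mul0r; apply: integral_ge0 => s /=.
  by rewrite in_itv/= andbT => s0; rewrite lee_fin mulr_ge0// expR_ge0.
pose w (s : R) := s * expR (- phi s / 2).
have mw : measurable_fun (`[0, +oo[%classic : set R) w.
  apply: (@eq_measurable_fun _ _ _ _ _ (fun s : R =>
    s * expR (- phi (Num.max 0 s) / 2))).
    by move=> s; rewrite inE/= in_itv/= andbT => s0; rewrite (max_idPr s0).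
  apply: measurable_funM => //.
  apply: measurableT_comp => //.
  apply: measurable_funM => //.
  apply: measurableT_comp => //.
  apply: nondecreasing_measurable => //; exact: young_max_homo.
(* The integral is cut to [0, t], where the weight is at least s e^(-phi(t)/2), with an explicit
   antiderivative. *)
apply: (@le_trans _ _
  (\int[lebesgue_measure]_(s in `[0%R, t]) (s * expR (- phi t / 2))%:E)%E).
  rewrite (@continuous_FTC2 _ _ (fun s => s ^+ 2 / 2 * expR (- phi t / 2))) //.
  - by rewrite expr0n/= !mul0r sube0.
  - apply: continuous_subspaceT => s.
    by apply: cvgM; [exact: cvg_id|exact: cvg_cst].
  - have c : continuous (fun s : R => s ^+ 2 / 2 * expR (- phi t / 2)).
      by move=> s; apply: differentiable_continuous; apply/derivable1_diffP.
    split => //; first exact/cvg_at_right_filter/c.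
    exact/cvg_at_left_filter/c.
  - by move=> s _; rewrite derive1E derive_val /GRing.scale/= !mulr0; field.
apply: (@le_trans _ _
  (\int[lebesgue_measure]_(s in `[0%R, t]) (s * expR (- phi s / 2))%:E)%E).
  apply: ge0_le_integral => //.
  - move=> s /=; rewrite in_itv/= => /andP[s0 _].
    by rewrite lee_fin mulr_ge0// expR_ge0.
  - by apply/measurable_EFinP; apply: measurable_funM.
  - apply/measurable_EFinP.
    by apply: measurable_funS mw => // s /=; rewrite !in_itv/= => /andP[->].
  - move=> s /=; rewrite in_itv/= => /andP[s0 st].
    rewrite lee_fin ler_wpM2l// ler_expR ler_wpM2r// lerN2.
    exact: young_homo_le.
apply: ge0_subset_integral => //.
- exact/measurable_EFinP.
- move=> s /=; rewrite in_itv/= andbT => s0.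
  by rewrite lee_fin mulr_ge0// expR_ge0.
- by move=> s /=; rewrite !in_itv/= => /andP[->].
Qed.

(** * Integrating a pointwise exponential bound *)

Section expectation.
Set Implicit Arguments.
Unset Strict Implicit.
Context d (T : measurableType d) (R : realType) (P : probability T R).

(* Since +oo - +oo = -oo, a finite expectation excludes that the positive and
   the negative part both have infinite integral. *)
Lemma Lfun1_expectation_fin (Z : T -> R) :
  measurable_fun [set: T] Z -> 'E_P[Z]%E \is a fin_num -> Z \in Lfun P 1.
Proof.
move=> mZ; rewrite unlock integralE fin_numB => /andP[fp fn].
apply/Lfun1_integrable/integrableP; split; first exact/measurable_EFinP.
under eq_integral do rewrite -/((abse \o (EFin \o Z)) _) fune_abse.
rewrite ge0_integralD//=; first by rewrite lte_add_pinfty ?ltey_eq ?fp ?fn.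
- exact/measurable_funepos/measurable_EFinP.
- exact/measurable_funeneg/measurable_EFinP.
Qed.

(** The linear term integrates to 0 and [1 + W] to at most 2. *)
Lemma mmt_gen_fun_le (Z W : T -> R) (l B : R) :
  measurable_fun [set: T] Z -> measurable_fun [set: T] W ->
  'E_P[Z]%E = 0%E -> (forall w, 0 <= W w) -> ('E_P[W] <= 1)%E -> 0 <= B ->
  (forall w, expR (l * Z w) <= 1 + l * Z w + B * (1 + W w)) ->
  ('M_P Z l <= (1 + 2 * B)%:E)%E.
Proof.
move=> mZ mW EZ W0 EW B0 bnd.
have LZ : Z \in Lfun P 1 by apply: Lfun1_expectation_fin => //; rewrite EZ.
have LW : W \in Lfun P 1.
  apply: Lfun1_expectation_fin => //; rewrite ge0_fin_numE ?expectation_ge0//.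
  exact: le_lt_trans EW (ltry _).
have LlZ := Lfun_scale l (lexx 1) LZ.
have LBW := Lfun_scale B (lexx 1) LW.
apply: (@le_trans _ _ 'E_P[(cst (1 + B)%R \+ (l \o* Z) \+ (B \o* W))%R]%E).
  apply: expectation_le.
  - by apply: measurableT_comp => //; exact: measurable_funM.
  - by do 2! [apply: measurable_funD; last exact: measurable_funM].
  - by move=> w; exact: expR_ge0.
  (* The dominating function is nonnegative because it lies above an exponential. *)
  - move=> w; apply: le_trans (expR_ge0 (l * Z w)) _; apply: le_trans (bnd w) _.
    rewrite /=; lra.
  - apply/aeW => w /=; rewrite mulrC; apply: le_trans (bnd w) _; lra.
have Lc : cst (1 + B) \in Lfun P 1 by exact: Lfun_cst.
have LcZ : (cst (1 + B) : T -> R) + (l \o* Z) \in Lfun P 1 by rewrite rpredD.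
rewrite (expectationD LcZ LBW) (expectationD Lc LlZ).
rewrite expectation_cst !expectationZl// EZ mule0 adde0.
apply: (@le_trans _ _ ((1 + B)%:E + B%:E * 1)%E).
  by rewrite leeD2l// lee_wpmul2l.
by rewrite mule1 -EFinD lee_fin; lra.
Qed.

End expectation.

(** * The bound for one admissible [u] and one positive [t] *)

Section transport_bound.
Set Implicit Arguments.
Unset Strict Implicit.
Context d (T : measurableType d) (R : realType) (P : probability T R).
Variables (Y : T -> R) (phi : R -> R) (M C : R).
Let psi := fun t : R => expR (phi t) - 1.
Hypotheses (mY : measurable_fun [set: T] Y) (EY : 'E_P[Y]%E = 0%E).
Hypotheses (phiY : is_young phi) (M0 : 0 < M).
Hypothesis conj_ge :
  (M%:E * \int[lebesgue_measure]_(t in `[0%R, +oo[) (t * expR (- phi t / 2))%:E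
     <= ereal_inf [set (expeR (convex_conjugate phi l) - 1) * (l ^- 2)%:E
                  | l in [set l : R | (0 < l)%R]])%E.
Hypotheses (C3 : 3 <= C) (MC : 9 <= 2 * M * C ^+ 2).

(** The assumption on [a] says that the conjugate at [m] is at most [a]; the integral hypothesis is
    used at this single [m]. *)
Lemma sqr_weight_le (m a t : R) : 0 < m -> 0 <= t ->
  (forall s, 0 <= s -> m * s - phi s <= a) ->
  M * m ^+ 2 * t ^+ 2 <= 2 * (expR a - 1) * expR (phi t / 2).
Proof.
move=> m0 t0 ma.
have conj_le : (convex_conjugate phi m <= a%:E)%E.
  by apply: ge_ereal_sup => _ [s /= s0 <-]; rewrite lee_fin ma.
have : (M%:E * (t ^+ 2 / 2 * expR (- phi t / 2))%:E <=
        (expR a - 1)%:E * (m ^- 2)%:E)%E.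
  apply: (@le_trans _ _ (M%:E * \int[lebesgue_measure]_(t in `[0%R, +oo[)
      (t * expR (- phi t / 2))%:E)%E).
    by rewrite lee_wpmul2l ?lee_fin ?(ltW M0)// young_weight_integral.
  apply: le_trans conj_ge _.
  apply: (@le_trans _ _ ((expeR (convex_conjugate phi m) - 1) * (m ^- 2)%:E)%E).
    by apply: ereal_inf_lbound; exists m.
  rewrite lee_wpmul2r ?lee_fin ?invr_ge0 ?exprn_ge0 ?(ltW m0)//.
  by rewrite EFinB leeB// -[(expR a)%:E]/(expeR a%:E) lee_expeR.
rewrite -!EFinM lee_fin ler_pdivlMr ?exprn_gt0//.
rewrite mulNr expRN [X in X <= _ -> _](_ : _ =
  M * m ^+ 2 * t ^+ 2 / 2 / expR (phi t / 2)); last by ring.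
by rewrite ler_pdivrMr ?expR_gt0//; lra.
Qed.

(** The two conditions on [C] play separate roles: [3 <= C] gives [l <= m / 2], hence the halved
    Young inequality [lt], while [9 <= 2 * M * C ^+ 2] absorbs [M] in [sq]. *)
Lemma expR_le_young (m a l x : R) : 0 < m -> l = 3 * m / (2 * C) ->
  (forall s, 0 <= s -> m * s - phi s <= a) ->
  expR (l * x) <= 1 + l * x +
    (expR a - 1) * expR (a / 2) / 2 * (1 + psi `|x|).
Proof.
move=> m0 lE ma; set t : R := `|x|.
have t0 : 0 <= t by exact: normr_ge0.
have a0 : 0 <= a by have := ma 0 (lexx 0); rewrite mulr0 (young0 phiY) subr0.
have C0 : 0 < C by apply: lt_le_trans C3.
have l0 : 0 < l by rewrite lE divr_gt0 ?mulr_gt0.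
have lm : l <= m / 2.
  have : 0 <= m * (C - 3) by rewrite mulr_ge0 ?subr_ge0// ltW.
  by rewrite lE ler_pdivrMr ?mulr_gt0//; lra.
have lt : l * t <= phi t / 2 + a / 2.
  by have := ma t t0; have := ler_wpM2r t0 lm; lra.
have sq : l ^+ 2 * t ^+ 2 <= (expR a - 1) * expR (phi t / 2).
  have h := sqr_weight_le m0 t0 ma.
  have : 9 * (M * m ^+ 2 * t ^+ 2) <=
      2 * M * C ^+ 2 * (2 * (expR a - 1) * expR (phi t / 2)).
    by apply: ler_pM => //; rewrite !mulr_ge0 ?sqr_ge0// ltW//.
  have -> : 9 * (M * m ^+ 2 * t ^+ 2) = (4 * M * C ^+ 2) * (l ^+ 2 * t ^+ 2).
    by rewrite lE; field; rewrite gt_eqF.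
  have -> : 2 * M * C ^+ 2 * (2 * (expR a - 1) * expR (phi t / 2)) =
    (4 * M * C ^+ 2) * ((expR a - 1) * expR (phi t / 2)) by ring.
  by rewrite ler_pM2l// !mulr_gt0.
apply: le_trans (expR_le_quadratic _) _.
rewrite lerD2l normrM (gtr0_norm l0) -/t.
have -> : (l * x) ^+ 2 = l ^+ 2 * t ^+ 2.
  by rewrite exprMn -(real_normK (num_real x)).
(* One half of [phi t] pays for the quadratic factor through [sq], the other for e^(l t) through
   [lt]. *)
have -> : (expR a - 1) * expR (a / 2) / 2 * (1 + psi t) =
    (expR a - 1) * expR (phi t / 2) / 2 * expR (phi t / 2 + a / 2).
  by rewrite /psi addrCA subrr addr0 [in LHS](splitr (phi t)) !expRD; ring.
apply: ler_pM; [|exact: expR_ge0| |by rewrite ler_expR].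
  by rewrite divr_ge0// mulr_ge0 ?sqr_ge0.
by rewrite ler_wpM2r ?invr_ge0.
Qed.

(** Since [a + phi t = m * t], the numerator r + 3a/2 is at most 3/2 m t, which is C t u times the
    parameter l/u. Positivity of [t] secures a positive slope [m]. *)
Lemma transport_bound_le (r t u : R) : 0 < t -> 2 * r / 3 <= phi t ->
  0 < u -> ('E_P[(fun w => psi (`|Y w| / u))%R] <= 1)%E ->
  (transport_bound P Y r <= (C * t * u)%:E)%E.
Proof.
move=> t0 rt u0 Eu; have [m m0 mt] := young_subgradient phiY t0.
set a : R := m * t - phi t in mt.
have C0 : 0 < C by apply: lt_le_trans C3.
have a0 : 0 <= a by have := mt 0 (lexx 0); rewrite mulr0 (young0 phiY) subr0.
pose l : R := 3 * m / (2 * C).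
have l0 : 0 < l by rewrite divr_gt0 ?mulr_gt0.
have ea1 : 1 <= expR a by rewrite -expR0 ler_expR.
have ea2 : 1 <= expR (a / 2) by rewrite -expR0 ler_expR divr_ge0.
pose B := (expR a - 1) * expR (a / 2) / 2.
have B0 : 0 <= B by rewrite divr_ge0 ?mulr_ge0 ?expR_ge0 ?subr_ge0.
have psi0 w : 0 <= psi (`|Y w| / u).
  by rewrite subr_ge0 -expR0 ler_expR (young_ge0 phiY)// divr_ge0// ltW.
have mgf : ('M_P Y (l / u) <= (1 + 2 * B)%:E)%E.
  apply: (mmt_gen_fun_le mY _ EY psi0 Eu B0).
    apply: (@eq_measurable_fun _ _ _ _ _ (fun w =>
      expR (phi (Num.max 0 (`|Y w| / u))) - 1)).
      by move=> w _; rewrite (max_idPr _)// divr_ge0// ltW.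
    apply: measurable_funB => //; apply: measurableT_comp => //.
    apply: (@measurableT_comp _ _ _ _ _ _ (fun s : R => phi (Num.max 0 s))).
      by apply: nondecreasing_measurable => //; exact: young_max_homo.
    by apply: measurable_funM => //; exact: measurableT_comp.
  move=> w; have := @expR_le_young m a l (Y w / u) m0 erefl mt.
  by rewrite normrM normfV (gtr0_norm u0) mulrA (mulrAC l).
have log : (log_mgf P Y (l / u) <= (3 * a / 2)%:E)%E.
  rewrite /log_mgf -[leRHS]expeRK lee_lne ?in_itv/= ?leey ?andbT//.
  (* Here 1 + 2B = 1 + (e^a - 1) e^(a/2), and 1 <= e^(a/2). *)
  - apply: le_trans mgf _; rewrite lee_fin.
    have -> : 3 * a / 2 = a + a / 2 by field.
    by rewrite expRD /B; nra.
  - by apply: expectation_ge0 => w; exact: expR_ge0.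
apply: (@le_trans _ _ ((r%:E + log_mgf P Y (l / u)) * ((l / u)^-1)%:E)%E).
  by apply: ereal_inf_lbound; exists (l / u) => //=; rewrite divr_gt0.
apply: (@le_trans _ _ ((r%:E + (3 * a / 2)%:E) * ((l / u)^-1)%:E)%E).
  rewrite lee_wpmul2r//; first by rewrite lee_fin invr_ge0 ltW// divr_gt0.
  by rewrite leeD2l.
rewrite -EFinD -EFinM lee_fin ler_pdivrMr; last exact: divr_gt0.
have -> : C * t * u * (l / u) = 3 / 2 * (m * t).
  by rewrite /l; field; rewrite !gt_eqF.
by rewrite /a; lra.
Qed.

End transport_bound.

(** * Passage to the inverse function and to the Orlicz norm *)

Theorem proposition4 (R : realType) (d d' : measure_display)
  (Omega : measurableType d) (S : measurableType d') (P : probability Omega R)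
  (X : {RV P >-> S}) (V : set (S -> R)) (phi : R -> R) (M : R) :
  let psi := fun t : R => expR (phi t) - 1 in
  centered_exp_space P X V ->
  is_young phi ->
  (forall g, V g -> (orlicz_norm P psi (g \o X) < +oo)%E) ->
  0 < M ->
  (M%:E * \int[lebesgue_measure]_(t in `[0%R, +oo[) (t * expR (- phi t / 2))%:E
     <= ereal_inf [set (expeR (convex_conjugate phi l) - 1) * (l ^- 2)%:E
                  | l in [set l : R | (0 < l)%R]])%E ->
  forall (f : S -> R) (r : R), V f -> 0 <= r ->
  (transport_bound P (f \o X) r
     <= (Num.max 3 (3 / Num.sqrt (2 * M)) * young_inv phi (2 * r / 3))%:E
        * orlicz_norm P psi (f \o X))%E.
Proof.
move=> psi VP phiY norm_fin M0 conj_ge f r Vf r0.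
set C := Num.max _ _; set t := young_inv phi _; set Y := f \o X.
have C3 : 3 <= C by rewrite le_max lexx.
have C0 : 0 < C by apply: lt_le_trans C3.
have MC : 9 <= 2 * M * C ^+ 2.
  have s0 : 0 < Num.sqrt (2 * M) by rewrite sqrtr_gt0 mulr_gt0.
  have h : 3 <= C * Num.sqrt (2 * M).
    by rewrite -ler_pdivrMr// le_max lexx orbT.
  have sM : Num.sqrt (2 * M) ^+ 2 = 2 * M by rewrite sqr_sqrtr// mulr_ge0// ltW.
  by rewrite -sM; have := ler_pM (ler0n R 3) (ler0n R 3) h h; lra.
have mY : measurable_fun [set: Omega] Y.
  by apply: measurableT_comp => //; exact: ces_measurable VP _ Vf.
have EY : 'E_P[Y]%E = 0%E by exact: ces_centered VP _ Vf.
have [t0 tE] : 0 <= t /\ phi t = 2 * r / 3.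
  by apply: young_inv_spec => //; rewrite divr_ge0 ?mulr_ge0.
have bound u : 0 < u -> ('E_P[(fun w => psi (`|Y w| / u))%R] <= 1)%E ->
    (transport_bound P Y r <= (C * t * u)%:E)%E.
  (* For [r = 0] the point [t] is 0, so the bound is applied slightly to the right of [t]; the shift
     is scaled to cost exactly [e]. *)
  move=> u0 Eu; apply/lee_addgt0Pr => e e0.
  have Cu : 0 < C * u by rewrite mulr_gt0.
  have -> : (C * t * u)%:E + e%:E = (C * (t + e / (C * u)) * u)%:E :> \bar R.
    by rewrite -EFinD; congr (_%:E); field; rewrite !gt_eqF.
  have te : t < t + e / (C * u) by rewrite ltrDl divr_gt0.
  apply: (transport_bound_le mY EY phiY M0 conj_ge C3 MC) => //.
    exact: le_lt_trans te.
  by rewrite -tE ltW// young_homo_lt.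
(* A finite norm provides an admissible [u0]. It settles the case [C * t = 0], where dividing by
   [C * t] to reach the infimum over [u] is impossible. *)
have [_ [u0 [u0_gt0 Eu0] <-] _] := ereal_inf_lt (norm_fin _ Vf).
have : 0 <= C * t by rewrite mulr_ge0// ltW.
rewrite le_eqVlt => /predU1P[Ct0|Ct0].
  by rewrite -Ct0 mul0e; have := bound _ u0_gt0 Eu0; rewrite -Ct0 mul0r.
rewrite -lee_pdivrMl//; apply: le_ereal_inf_tmp => _ [u [u_gt0 Eu] <-].
by rewrite lee_pdivrMl// -EFinM bound.
Qed.
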